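(* For all integers $n,r,s,k\ge 0$, we have \begin{align*} \bar{b}^k_{3r,3s}(3n+1)&\equiv \bar{b}^k_{3r,3s}(3n+2)\equiv 0\pmod{3},\\ \bar{b}^{3k+2}_{3r+1,3s}(3n+1)&\equiv\bar{b}^{3k+1}_{3r+2,3s}(3n+1)\equiv 0\pmod{3},\\ \bar{b}^{3k+2}_{3r+1,3s+1}(3n+2)&\equiv\bar{b}^{3k+1}_{3r+2,3s+2}(3n+2)\equiv 0\pmod{3}. \end{align*}
   Context: Write $f_m=\prod_{i\ge 1}(1-q^{mi})$ for $m\ge 1$, and $f_m^a$ for its $a$-th power. For integers $r,s,k\ge 1$, $\bar{b}^k_{r,s}(n)$ denotes the number of overcolored partition $k$-tuples of $n$: $k$-tuples of partitions of total weight $n$ in which each even part may appear in one of $r$ colors, each odd part may appear in one of $s$ colors, and the first occurrence of each part (of each color) in each component may be overlined. Equivalently, as formal power series in $q$, \[\sum_{n=0}^{\infty}\bar{b}^k_{r,s}(n)q^n=\frac{f_2^{(3s-2r)k}}{f_1^{2sk}f_4^{(s-r)k}}.\] If some of $r,s,k$ are $0$, $\bar{b}^k_{r,s}(n)$ is understood to be defined by this generating function. (The superscript is the number of components of the tuple, not a power.) *)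

(* Defs.v *)
From mathcomp Require Import all_boot all_algebra ring.

Set Implicit Arguments.
Unset Strict Implicit.
Unset Printing Implicit Defensive.

Import GRing.Theory.

Definition ncolors (r s p : nat) : nat := if odd p then s else r.

(* The element (i, Tagged _ c) with c : 'I_(ncolors r s p.+1) is the part p.+1
   in colour c in the i-th component of a k-tuple; parts are bounded by N. *)
Definition cpart (r s k N : nat) : finType :=
  ('I_k * {p : 'I_N & 'I_(ncolors r s p.+1)})%type.

Definition part_size r s k N (x : cpart r s k N) : nat := (tag x.2).+1.

(* A tuple assigns to each coloured part of each component its multiplicity and
   a flag telling whether its first occurrence is overlined; only a part that
   occurs can be overlined. *)
Definition overcolored r s k N (f : {ffun cpart r s k N -> 'I_N.+1 * bool}) :
    bool :=
  [forall x, (f x).2 ==> (0 < (f x).1)].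

Definition weight r s k N (f : {ffun cpart r s k N -> 'I_N.+1 * bool}) : nat :=
  \sum_x part_size x * (f x).1.

Definition overcolored_tuples r s k N n :
    {set {ffun cpart r s k N -> 'I_N.+1 * bool}} :=
  [set f | overcolored f & weight f == n].

(* In weight n, parts and multiplicities are at most n, so the bound N := n
   loses nothing. *)
Definition bbar (r s k n : nat) : nat := #|overcolored_tuples r s k n n|.

Local Open Scope ring_scope.

(* The product f_m modulo q^(N+1), for m > 0. *)
Definition euler (N m : nat) : {poly int} :=
  \prod_(1 <= i < N.+1) (1 - 'X^(m * i)).

Definition eqm n (a b : {poly int}) := forall i, (i < n)%N -> a`_i = b`_i.

Lemma eqm_refl n a : eqm n a a. Proof. by []. Qed.

Lemma eqm_sym n a b : eqm n a b -> eqm n b a.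
Proof. by move=> H i Hi; rewrite H. Qed.

Lemma eqm_trans n a b c : eqm n a b -> eqm n b c -> eqm n a c.
Proof. by move=> H K i Hi; rewrite H // K. Qed.

Lemma eqmD n a b c d : eqm n a b -> eqm n c d -> eqm n (a + c) (b + d).
Proof. by move=> H K i Hi; rewrite !coefD H // K. Qed.

Lemma eqmN n a b : eqm n a b -> eqm n (- a) (- b).
Proof. by move=> H i Hi; rewrite !coefN H. Qed.

Lemma eqmM n a b c d : eqm n a b -> eqm n c d -> eqm n (a * c) (b * d).
Proof.
move=> H K i Hi; rewrite !coefM; apply: eq_bigr => j _.
rewrite H; last by rewrite (leq_ltn_trans _ Hi) // -ltnS.
by rewrite K // (leq_ltn_trans (leq_subr _ _)).
Qed.

Lemma eqmX n a b e : eqm n a b -> eqm n (a ^+ e) (b ^+ e).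
Proof. by move=> H; elim: e => // e IH; rewrite !exprS; exact: eqmM. Qed.

Lemma eqm_prod n (I : Type) (l : seq I) (P : pred I) F G :
  (forall i, P i -> eqm n (F i) (G i)) ->
  eqm n (\prod_(i <- l | P i) F i) (\prod_(i <- l | P i) G i).
Proof.
by move=> H; apply: big_ind2 => // a b c d; exact: eqmM.
Qed.

Lemma eqm_prod1 n m p (P : pred nat) F :
  (forall i, (m <= i < p)%N -> eqm n (F i) 1) ->
  eqm n (\prod_(m <= i < p | P i) F i) 1.
Proof.
move=> H; rewrite big_nat_cond.
apply: (big_ind (fun a => eqm n a 1)) => // [a b Ha Hb|i /andP[/H]//].
by rewrite -[X in eqm _ _ X]mulr1; exact: eqmM.
Qed.

Lemma eqm_sum0 n m p F :
  (forall i, (m <= i < p)%N -> eqm n (F i) 0) ->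
  eqm n ((\sum_(m <= i < p) F i) *+ 2) 0.
Proof.
move=> H; rewrite big_nat_cond.
suff K : eqm n (\sum_(m <= i < p | (m <= i < p)%N && true) F i) 0.
  by move=> i Hi; rewrite coefMn K // coef0 mul0rn.
apply: (big_ind (fun a => eqm n a 0)) => // [a b Ha Hb|i /andP[/H]//].
by rewrite -[X in eqm _ _ X]addr0; exact: eqmD.
Qed.

Lemma eqmD0 n a b : eqm n b 0 -> eqm n (a + b) a.
Proof. by move=> H; rewrite -[X in eqm _ _ X]addr0; exact: eqmD. Qed.

Lemma eqmM1 n a b : eqm n b 1 -> eqm n (a * b) a.
Proof. by move=> H; rewrite -[X in eqm _ _ X]mulr1; exact: eqmM. Qed.

Lemma eqm_Xn n e : (n <= e)%N -> eqm n 'X^e 0.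
Proof.
move=> H i Hi; rewrite coefXn coef0; case: eqP => // E.
by move: Hi; rewrite E ltnNge H.
Qed.

Definition factor N p : {poly int} :=
  \sum_(y : 'I_N.+1 * bool | y.2 ==> (0 < y.1)%N) 'X^(p * y.1).

Lemma factorE N p :
  factor N p = 1 + (\sum_(1 <= j < N.+1) 'X^(p * j)) *+ 2.
Proof.
transitivity (\sum_(j < N.+1) \sum_(b : bool | b ==> (0 < j)%N)
   ('X^(p * j) : {poly int})); last first.
  rewrite big_ord_recl /=; congr (_ + _).
    by rewrite big_mkcond big_bool /= muln0 add0r.
  rewrite big_add1 big_mkord /= -sumrMnl; apply: eq_bigr => j _.
  by rewrite big_mkcond big_bool /= mulr2n.
by rewrite (pair_big_dep predT (fun (j : 'I_N.+1) b => b ==> (0 < j)%N)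
  (fun j b => 'X^(p * j))).
Qed.

Lemma factor_rat N p : (0 < p)%N ->
  eqm N.+1 (factor N p * (1 - 'X^p)) (1 + 'X^p).
Proof.
move=> p0; rewrite factorE.
have -> : (1 + (\sum_(1 <= j < N.+1) 'X^(p * j)) *+ 2) * (1 - 'X^p) =
   1 + 'X^p - 'X^(p * N.+1) *+ 2 :> {poly int}.
  elim: N => [|N IH].
    by rewrite big_geq // mul0rn addr0 mul1r muln1 mulr2n opprD addrA addrK.
  rewrite big_nat_recr //= mulrnDl addrA mulrDl IH.
  rewrite mulrBr mulr1 mulrnAl -exprD -mulnSr.
  by rewrite addrA subrK.
move=> i Hi; rewrite !coefB coefMn (@eqm_Xn N.+1) ?coef0 ?mul0rn ?subr0 //.
exact: leq_pmull.
Qed.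

Lemma factor_stable N n p : (n <= N)%N -> (0 < p)%N ->
  eqm n.+1 (factor N p) (factor n p).
Proof.
move=> le_nN p0.
rewrite !factorE (@big_cat_nat _ _ _ n.+1 1 N.+1) // mulrnDl addrA.
apply/eqmD0/eqm_sum0 => i /andP[Hi _].
by apply: eqm_Xn; exact: leq_trans Hi (leq_pmull _ _).
Qed.

Lemma factor_big n p : (n < p)%N -> eqm n.+1 (factor n p) 1.
Proof.
move=> np; rewrite factorE; apply/eqmD0/eqm_sum0 => i /andP[Hi _].
by apply: eqm_Xn; exact: leq_trans np (leq_pmulr _ Hi).
Qed.

Lemma coef_tuples r s k N n :
  (\prod_(x : cpart r s k N) factor N (part_size x))`_n =
  #|overcolored_tuples r s k N n|%:R.
Proof.
rewrite /factor (bigA_distr_big (fun y : 'I_N.+1 * bool => y.2 ==> (0 < y.1)%N)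
  (fun (x : cpart r s k N) (y : 'I_N.+1 * bool) => 'X^(part_size x * y.1))).
rewrite coef_sum.
under eq_bigr => f _ do rewrite -expr_sum coefXn.
rewrite -sum1_card natr_sum big_mkcond [RHS]big_mkcond /=.
apply: eq_bigr => f _.
transitivity (if overcolored f then (n == weight f)%:R else 0 : int).
  by congr (if _ then _ else _); apply/ffun_onP/forallP.
by rewrite in_set eq_sym; case: (overcolored f) => //=; case: eqP.
Qed.

Lemma prod_cpart r s k N (F : nat -> {poly int}) :
  \prod_(x : cpart r s k N) F (part_size x) =
  \prod_(1 <= p < N.+1) F p ^+ (ncolors r s p * k).
Proof.
transitivity (\prod_(i < k)
   \prod_(y : {p : 'I_N & 'I_(ncolors r s p.+1)}) F (tag y).+1).
  by rewrite (pair_bigA _ (fun (i : 'I_k)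
    (y : {p : 'I_N & 'I_(ncolors r s p.+1)}) => F (tag y).+1)).
rewrite prodr_const card_ord.
have -> : \prod_(y : {p : 'I_N & 'I_(ncolors r s p.+1)}) F (tag y).+1 =
   \prod_(p < N) \prod_(c < ncolors r s p.+1) F p.+1.
  by rewrite sig_big_dep.
rewrite big_add1 big_mkord -prodrXl; apply: eq_bigr => p _.
by rewrite prodr_const card_ord exprM.
Qed.

Definition gpoly r s k N : {poly int} :=
  \prod_(1 <= p < N.+1) factor N p ^+ (ncolors r s p * k).

Lemma gpoly_stable r s k N n : (n <= N)%N ->
  eqm n.+1 (gpoly r s k N) (gpoly r s k n).
Proof.
move=> le_nN; rewrite /gpoly (@big_cat_nat _ _ _ n.+1 1 N.+1) //.
apply: (@eqm_trans _ _ (\prod_(1 <= p < n.+1)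
   factor N p ^+ (ncolors r s p * k))).
  apply/eqmM1/eqm_prod1 => p /andP[np _].
  rewrite -(expr1n _ (ncolors r s p * k)); apply: eqmX.
  apply: eqm_trans (factor_big np).
  by apply: factor_stable => //; exact: leq_trans np.
rewrite big_nat [X in eqm _ _ X]big_nat; apply: eqm_prod => p /andP[p0 _].
exact/eqmX/factor_stable.
Qed.

Lemma bbar_gpoly r s k N n : (n <= N)%N ->
  (bbar r s k n)%:R = (gpoly r s k N)`_n.
Proof.
move=> le_nN; rewrite (gpoly_stable r s k le_nN) // /gpoly -prod_cpart.
by rewrite coef_tuples.
Qed.

Definition prodO N (F : nat -> {poly int}) :=
  \prod_(1 <= p < N.+1 | odd p) F p.
Definition prodE N (F : nat -> {poly int}) :=
  \prod_(1 <= p < N.+1 | ~~ odd p) F p.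

Lemma gpoly_split r s k N :
  gpoly r s k N = prodE N (factor N) ^+ (r * k) * prodO N (factor N) ^+ (s * k).
Proof.
rewrite /gpoly (bigID odd) /= mulrC -!prodrXl; congr (_ * _);
  by apply: eq_bigr => p; rewrite /ncolors; case: odd.
Qed.

Lemma prodE_half N F G : (forall p, (N < p)%N -> eqm N.+1 (F p) 1) ->
  (forall i, G i = F (2 * i)%N) ->
  eqm N.+1 (prodE N F) (\prod_(1 <= i < N.+1) G i).
Proof.
move=> HF HG.
have E M : \prod_(1 <= i < M.+1) F (2 * i)%N = prodE (2 * M) F.
  rewrite /prodE; elim: M => [|M IH]; first by rewrite !big_geq.
  rewrite big_nat_recr //= IH mulnS addnC addn2.
  rewrite [X in X * _]big_mkcond [RHS]big_mkcond /=.
  rewrite [RHS]big_nat_recr //= [X in _ = X * _]big_nat_recr //=.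
  by rewrite !mul2n odd_double /= mulr1.
under eq_bigr do rewrite HG.
rewrite E /prodE (@big_cat_nat _ _ _ N.+1 1 (2 * N).+1) //; last first.
  by rewrite ltnS leq_pmull.
by apply: eqm_sym; apply/eqmM1/eqm_prod1 => p /andP[/HF].
Qed.

Lemma eqm_1BX N e : (N < e)%N -> eqm N.+1 (1 - 'X^e) 1.
Proof.
move=> H; rewrite -[X in eqm _ _ X]subr0; apply: eqmD => //.
exact/eqmN/eqm_Xn.
Qed.

Lemma gpoly_gf r s k N :
  eqm N.+1
    (gpoly r s k N * euler N 1 ^+ (2 * s * k) * euler N 4 ^+ (s * k)
       * euler N 2 ^+ (2 * r * k))
    (euler N 2 ^+ (3 * s * k) * euler N 4 ^+ (r * k)).
Proof.
pose A p : {poly int} := 1 - 'X^p.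
pose B p : {poly int} := 1 + 'X^p.
set Ae := prodE N A; set Ao := prodO N A.
set Be := prodE N B; set Bo := prodO N B.
have f1E : euler N 1 = Ae * Ao.
  rewrite /euler (bigID odd) /= mulrC.
  by congr (_ * _); apply: eq_bigr => p _; rewrite mul1n.
have AB p : A p * B p = 1 - 'X^(2 * p).
  by rewrite /A /B -subr_sqr expr1n -exprM mulnC.
have f2E : euler N 2 = Ae * Ao * (Be * Bo).
  rewrite /euler; under eq_bigr do rewrite -AB.
  rewrite big_split /= (bigID odd) /= [X in _ * X](bigID odd) /=.
  by rewrite [X in X * _]mulrC [X in _ * X]mulrC.
have f2Ae : eqm N.+1 (euler N 2) Ae.
  by apply: eqm_sym; apply: prodE_half => // p; exact: eqm_1BX.
have f4E : eqm N.+1 (euler N 4) (Ae * Be).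
  apply: eqm_sym; rewrite /Ae /Be /prodE -big_split /=.
  under eq_bigr do rewrite AB.
  apply: (@prodE_half N (fun p => 1 - 'X^(2 * p))) => [p Hp|i].
    by apply: eqm_1BX; exact: leq_trans Hp (leq_pmull _ _).
  by rewrite mulnA.
have AA : eqm N.+1 (Ae * Ao * (Be * Bo)) Ae by rewrite -f2E.
have HE : eqm N.+1 (prodE N (factor N) * Ae) Be.
  rewrite /Ae /prodE -big_split /= big_nat_cond [X in eqm _ _ X]big_nat_cond.
  by apply: eqm_prod => p /andP[/andP[p0 _] _]; exact: factor_rat.
have HO : eqm N.+1 (prodO N (factor N) * Ao) Bo.
  rewrite /Ao /prodO -big_split /= big_nat_cond [X in eqm _ _ X]big_nat_cond.
  by apply: eqm_prod => p /andP[/andP[p0 _] _]; exact: factor_rat.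
rewrite gpoly_split f1E.
set GE := prodE N (factor N) in HE *; set GO := prodO N (factor N) in HO *.
rewrite -![(_ * s * k)%N]mulnA -![(_ * r * k)%N]mulnA.
move: (s * k)%N (r * k)%N => v u.
apply: (@eqm_trans _ _ (GE ^+ u * GO ^+ v * (Ae * Ao) ^+ (2 * v)
   * (Ae * Be) ^+ v * Ae ^+ (2 * u))).
  by apply: eqmM; [apply: eqmM => //|]; apply: eqmX.
apply: (@eqm_trans _ _ (Ae ^+ (3 * v) * (Ae * Be) ^+ u)); last first.
  by apply: eqm_sym; apply: eqmM; apply: eqmX.
have -> : GE ^+ u * GO ^+ v * (Ae * Ao) ^+ (2 * v) * (Ae * Be) ^+ v
   * Ae ^+ (2 * u) =
   (GE * Ae) ^+ u * (GO * Ao) ^+ v * (Ae ^+ (2 * v) * (Ae * Ao * Be) ^+ v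
   * Ae ^+ u).
  by rewrite ![(2 * _)%N]mulnC ?[(3 * _)%N]mulnC !exprM !exprMn; ring.
apply: (@eqm_trans _ _ (Be ^+ u * Bo ^+ v * (Ae ^+ (2 * v)
   * (Ae * Ao * Be) ^+ v * Ae ^+ u))).
  by apply: eqmM => //; apply: eqmM; apply: eqmX.
have -> : Be ^+ u * Bo ^+ v * (Ae ^+ (2 * v) * (Ae * Ao * Be) ^+ v * Ae ^+ u) =
   (Ae * Ao * (Be * Bo)) ^+ v * (Ae ^+ (2 * v) * (Ae * Be) ^+ u).
  by rewrite ![(2 * _)%N]mulnC ?[(3 * _)%N]mulnC !exprM !exprMn; ring.
have -> : Ae ^+ (3 * v) * (Ae * Be) ^+ u =
   Ae ^+ v * (Ae ^+ (2 * v) * (Ae * Be) ^+ u).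
  by rewrite ![(2 * _)%N]mulnC ?[(3 * _)%N]mulnC !exprM !exprMn; ring.
by apply: eqmM => //; apply: eqmX.
Qed.

(* The identity sum_n bbar r s k n q^n = f_2^((3s-2r)k) / (f_1^(2sk) f_4^((s-r)k))
   with negative exponents cleared, modulo q^(N+1).  As the f_m have constant
   term 1, it determines bbar; it holds also when some of r, s, k vanish. *)
Lemma bbar_gf r s k N :
  take_poly N.+1
    ((\poly_(n < N.+1) (bbar r s k n)%:R)
     * euler N 1 ^+ (2 * s * k) * euler N 4 ^+ (s * k) * euler N 2 ^+ (2 * r * k))
  = take_poly N.+1 (euler N 2 ^+ (3 * s * k) * euler N 4 ^+ (r * k)).
Proof.
apply/polyP => i; rewrite !coef_take_poly; case: ifP => // Hi.
rewrite -gpoly_gf //; do 3![apply: (@eqmM N.+1) => //] => j Hj.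
by rewrite coef_poly Hj (@bbar_gpoly _ _ _ N).
Qed.

(* Main.v *)
(* The overpartition products are inverse theta functions: by Gauss,
   f_1^2 / f_2 = phi(-q) := 1 + 2 sum_(j >= 1) (-1)^j q^(j^2).  The generating
   function of bbar is P^(rk) Q^(sk), where P = 1 / phi(-q^2) collects the even
   parts and Q the odd ones, and P Q = 1 / phi(-q).  Modulo 3 a cube is a series
   in q^3.  In the three cases the generating function is a cube times 1,
   phi(-q^2) and phi(-q) respectively, and the exponents 0, 2 j^2 and j^2 avoid
   the residue classes 1 and 2, the class 1, and the class 2 modulo 3. *)
Require Import Defs.
From mathcomp Require Import all_boot.
From mathcomp Require Import all_algebra ring.

Set Implicit Arguments.
Unset Strict Implicit.
Unset Printing Implicit Defensive.

Import GRing.Theory.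

(** * Gauss's identity for phi(-q) in finite form *)

Section Gauss.
Local Open Scope ring_scope.
Variables (R : comNzRingType) (q : R).

(** For m >= 1 this is, up to a factor free of [n], the quotient (q;q)_(n-1) / (-q;q)_n with
    denominators cleared; hence the index i = n is skipped. *)
Definition gauss_weight m M n : R :=
  \prod_(m <= i < n) (1 - q ^+ i) * \prod_(n.+1 <= i < M) (1 + q ^+ i).

(** Each summand is the drop of z^n \prod_(m <= i < n) (1 - q^i) \prod_(n <= i < M) (1 + q^i) from n
    to n + 1, since (1 + q^n) - z (1 - q^n) = (1 - z) + (1 + z) q^n. *)
Lemma gauss_telescope (z : R) m M : (m <= M)%N ->
  \sum_(m <= n < M) z ^+ n * gauss_weight m M n * ((1 - z) + (1 + z) * q ^+ n) =
  z ^+ m * \prod_(m <= i < M) (1 + q ^+ i)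
    - z ^+ M * \prod_(m <= i < M) (1 - q ^+ i).
Proof.
move=> le_mM.
pose u n := - (z ^+ n * (\prod_(m <= i < n) (1 - q ^+ i)
                         * \prod_(n <= i < M) (1 + q ^+ i))).
rewrite (eq_big_nat _ _ (F2 := fun n => u n.+1 - u n)) => [|n /andP[mn nM]].
  rewrite telescope_sumr // /u !(big_geq (leqnn _)) mul1r mulr1.
  by rewrite opprK addrC.
rewrite /u /gauss_weight (big_nat_recr n) //= (big_ltn nM) exprS; ring.
Qed.

(* Error term of Gauss's identity with the series cut to j < m (after Andrews and
   Merca) and the denominators cleared: modulo q^M, the truncated series times
   \prod_(i < M) (1 + q^i) is \prod_(i < M) (1 - q^i) -+ 2 gauss_tail m M. *)
Definition gauss_tail m M : R := \prod_(1 <= i < m) (1 + q ^+ i)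
  * \sum_(m <= n < M) q ^+ (m * n) * gauss_weight m M n.

(** Telescoping at z = q^m over n > m: the factor 1 - q^m completes the weights of the tail at m,
    while (1 + q^m) q^n yields the tail at m + 1. The term n = m and the lower boundary term combine
    to q^(m^2) times the full product. *)
Lemma gauss_tail_step m M : (0 < m < M)%N ->
  gauss_tail m M + gauss_tail m.+1 M =
  q ^+ (m ^ 2) * \prod_(1 <= i < M) (1 + q ^+ i)
    - q ^+ (m * M) * (\prod_(1 <= i < m) (1 + q ^+ i)
                      * \prod_(m.+1 <= i < M) (1 - q ^+ i)).
Proof.
case/andP=> m0 mM; rewrite /gauss_tail big_nat_recr //=.
rewrite (@big_cat_nat _ _ _ m 1 M) //=; last exact: ltnW.
rewrite (big_ltn mM) {1}/gauss_weight (big_geq (leqnn m)) mul1r (big_ltn mM).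
have := gauss_telescope (q ^+ m) mM.
have -> : \sum_(m.+1 <= n < M) (q ^+ m) ^+ n * gauss_weight m.+1 M n
             * ((1 - q ^+ m) + (1 + q ^+ m) * q ^+ n) =
  \sum_(m.+1 <= n < M) q ^+ (m * n) * gauss_weight m M n
  + (1 + q ^+ m) * \sum_(m.+1 <= n < M) q ^+ (m.+1 * n) * gauss_weight m.+1 M n.
  rewrite mulr_sumr -big_split; apply: eq_big_nat => n /andP[mn _] /=.
  rewrite /gauss_weight (big_ltn mn) mulSn exprD -exprM; ring.
rewrite -!exprM mulnS exprD mulnn.
move/(canRL (addrK _)) => ->.
ring.
Qed.

Definition theta N : R :=
  1 + (\sum_(1 <= j < N.+1) (-1) ^+ j * q ^+ (j ^ 2)) *+ 2.

Lemma gauss_theta N : exists c,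
  theta N * \prod_(1 <= i < N.+1) (1 + q ^+ i) =
  \prod_(1 <= i < N.+1) (1 - q ^+ i) + q ^+ N.+1 * c.
Proof.
set B := \prod_(1 <= i < N.+1) (1 + q ^+ i).
(* The alternating sum of the relations [gauss_tail_step] telescopes. *)
have partial m : (m <= N)%N -> exists c,
    (\sum_(1 <= j < m.+1) (-1) ^+ j * q ^+ (j ^ 2)) * B =
    (-1) ^+ m * gauss_tail m.+1 N.+1 - gauss_tail 1 N.+1 + q ^+ N.+1 * c.
  elim: m => [|m IH] mN.
    by exists 0; rewrite big_geq // mul0r mul1r subrr mulr0 addr0.
  have [c Hc] := IH (ltnW mN).
  rewrite big_nat_recr //= mulrDl Hc -mulrA.
  have := @gauss_tail_step m.+1 N.+1; rewrite /= ltnS => /(_ mN).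
  move/(canLR (subrK _)) <-.
  exists (c + (-1) * (-1) ^+ m * q ^+ (m * N.+1)
    * (\prod_(1 <= i < m.+1) (1 + q ^+ i)
       * \prod_(m.+2 <= i < N.+1) (1 - q ^+ i))).
  rewrite mulSn exprD (exprS (-1) m); ring.
have [c Hc] := partial N (leqnn N).
exists (c *+ 2); rewrite /theta mulrDl mulrnAl Hc mul1r.
(* At z = 1 the last factor is 2 q^n, so the two full products differ by twice
   [gauss_tail 1 N.+1]. *)
have := @gauss_telescope 1 1 N.+1 isT.
rewrite !expr1n !mul1r -/B.
have -> : \sum_(1 <= n < N.+1) 1 ^+ n * gauss_weight 1 N.+1 n
    * ((1 - 1) + (1 + 1) * q ^+ n) = gauss_tail 1 N.+1 *+ 2.
  rewrite /gauss_tail big_geq // mul1r -sumrMnl; apply: eq_bigr => n _.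
  by rewrite expr1n mul1n; ring.
move/(canLR (subrK _)) <-.
have -> : gauss_tail N.+1 N.+1 = 0.
  by rewrite /gauss_tail [X in _ * X]big_geq ?mulr0.
ring.
Qed.

End Gauss.

(** * Inverse theta functions and cubes modulo 3 *)

Section Congruences.
Local Open Scope ring_scope.

Lemma eqm_cancel n (a b c : {poly int}) :
  c`_0 = 1 -> eqm n (a * c) (b * c) -> eqm n a b.
Proof.
move=> c1 H; elim/ltn_ind=> i IH i_n.
have := H i i_n; rewrite !coefM !big_ord_recr /= subnn c1 !mulr1.
rewrite (eq_bigr (fun j : 'I_i => b`_j * c`_(i - j))) => [/addrI//|j _].
by rewrite IH // (ltn_trans _ i_n).
Qed.

(** Frobenius is additive, so only the terms c_j^p X^(p j) occur. *)
Lemma coef_expr_pchar (R : comNzRingType) p (f : {poly R}) i :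
  p \in [pchar R] -> ~~ (p %| i)%N -> (f ^+ p)`_i = 0.
Proof.
move=> pR; have p0 : (0 < p)%N by rewrite prime_gt0 // (pcharf_prime pR).
have pP : p \in [pchar {poly R}] by rewrite pchar_poly.
elim/poly_ind: f i => [|f c IH] i; first by rewrite expr0n gtn_eqF // coef0.
move=> pi; rewrite -(pFrobenius_autE pP) rmorphD /= !pFrobenius_autE.
rewrite exprMn -polyC_exp coefD coefMXn coefC.
have -> /= : (i == 0)%N = false by apply: contraNF pi => /eqP ->; rewrite dvdn0.
rewrite addr0; case: ltnP => // le_pi; apply: IH.
by rewrite dvdn_subl.
Qed.

Lemma coef_theta d N m : (forall j, m != d * j ^ 2)%N ->
  (theta ('X^d : {poly int}) N)`_m = 0.
Proof.
move=> H; rewrite /theta coefD coefMn coef_sum big1_seq => [|j _].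
  (* The case j = 0 of [H] disposes of the constant term. *)
  by rewrite mul0rn addr0 coef1; have := H 0; rewrite muln0 => /negPf ->.
by rewrite -exprM -signr_odd mulr_sign; case: ifP; rewrite ?coefN coefXn
  (negPf (H j)) ?oppr0.
Qed.

(** After multiplication by the product of the 1 + X^(d i), which can be cancelled, this is Gauss's
    identity at q = X^d; its error is a multiple of X^(d (N+1)). *)
Lemma theta_inv d N (G : {poly int}) : (0 < d)%N ->
  eqm N.+1 (G * \prod_(1 <= i < N.+1) (1 - 'X^(d * i)))
           (\prod_(1 <= i < N.+1) (1 + 'X^(d * i))) ->
  eqm N.+1 (G * theta 'X^d N) 1.
Proof.
move=> d0 HG; set B := (X in eqm _ _ X) in HG.
have B0 : B`_0 = 1.
  rewrite -horner_coef0 horner_prod big_nat big1 // => i /andP[i0 _].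
  by rewrite hornerD hornerC hornerXn expr0n gtn_eqF ?muln_gt0 ?d0 // addr0.
apply: (eqm_cancel B0); rewrite mul1r -mulrA.
have [c] := gauss_theta ('X^d : {poly int}) N.
under eq_bigr do rewrite -exprM.
under [in X in _ = X -> _]eq_bigr do rewrite -exprM.
rewrite -/B => ->; rewrite mulrDr.
apply: eqm_trans HG; apply: eqmD0.
rewrite mulrCA -[X in eqm _ _ X](mul0r (G * c)); apply: eqmM => //.
by rewrite -exprM; apply: eqm_Xn; exact: leq_pmull.
Qed.

Lemma theta_prodE N : eqm N.+1 (prodE N (factor N) * theta 'X^2 N) 1.
Proof.
apply: theta_inv => //.
apply: (@eqm_trans _ _ ((\prod_(1 <= i < N.+1) factor N (2 * i))
                        * \prod_(1 <= i < N.+1) (1 - 'X^(2 * i)))).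
  (* Parts 2i > N contribute factors that are 1 modulo X^(N+1). *)
  by apply: eqmM => //; apply: prodE_half => // p; exact: factor_big.
rewrite -big_split /= big_nat [X in eqm _ _ X]big_nat.
apply: eqm_prod => i /andP[i0 _]; apply: factor_rat.
by rewrite muln_gt0.
Qed.

Lemma theta_prodEO N :
  eqm N.+1 (prodE N (factor N) * prodO N (factor N) * theta 'X^1 N) 1.
Proof.
apply: theta_inv => //.
have -> : prodE N (factor N) * prodO N (factor N) =
    \prod_(1 <= i < N.+1) factor N i.
  by rewrite [RHS](bigID odd) /= mulrC.
rewrite -big_split /= big_nat [X in eqm _ _ X]big_nat.
by apply: eqm_prod => i /andP[i0 _]; rewrite mul1n; exact: factor_rat.
Qed.

(** Modulo 3 the cube contributes only exponents i divisible by 3, and these meet coefficients of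
    [F] at N - i, which is congruent to N. *)
Lemma bbar_cube r s k N (C F : {poly int}) :
  eqm N.+1 (gpoly r s k N) (C ^+ 3 * F) ->
  (forall j, j = N %[mod 3] -> F`_j = 0) -> bbar r s k N = 0 %[mod 3].
Proof.
move=> HG HF; rewrite mod0n; apply/eqP.
have ch : 3 \in [pchar 'F_3] by exact: pchar_Fp.
rewrite -/(3 %| _)%N (dvdn_pcharf ch) -(rmorph_nat (intmul (1 : 'F_3))).
rewrite (@bbar_gpoly _ _ _ N) // HG // coefM rmorph_sum big1 // => i _.
rewrite rmorphM /=; have [/eqP i3|i3] := boolP (3 %| i)%N.
  rewrite HF ?rmorph0 ?mulr0 //.
  by rewrite -[in RHS](subnK (ltnSE (ltn_ord i))) -modnDmr i3 addn0.
by rewrite -coef_map rmorphXn /= coef_expr_pchar // mul0r.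
Qed.

(** Only the exponent of [P] falls one short of a multiple of 3, leaving 1 / P = phi(-q^2). *)
Lemma bbar_phi_even r s k N u v : (r * k = 3 * u + 2)%N -> (s * k = 3 * v)%N ->
  N = 1 %[mod 3] -> bbar r s k N = 0 %[mod 3].
Proof.
move=> Hr Hs HN; set P := prodE N (factor N); set Q := prodO N (factor N).
apply: (@bbar_cube _ _ _ _ (P ^+ u.+1 * Q ^+ v) (theta 'X^2 N)).
  rewrite gpoly_split Hr Hs -/P -/Q.
  have -> : (P ^+ u.+1 * Q ^+ v) ^+ 3 * theta 'X^2 N =
      P ^+ (3 * u + 2) * Q ^+ (3 * v) * (P * theta 'X^2 N).
    rewrite exprMn -!exprM mulSn mulnC (mulnC v) [(3 + _)%N]addnC.
    by rewrite !exprD; ring.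
  by apply/eqm_sym/eqmM1; exact: theta_prodE.
move=> m; rewrite HN => Hm; apply: coef_theta => j; apply/eqP => mE; move: Hm.
rewrite mE -modnMmr -modnXm; have := ltn_pmod j (isT : 0 < 3)%N.
by case: (j %% 3)%N => [|[|[|]]].
Qed.

(** Both exponents fall one short of a multiple of 3, leaving 1 / (P Q) = phi(-q). *)
Lemma bbar_phi r s k N u v : (r * k = 3 * u + 2)%N -> (s * k = 3 * v + 2)%N ->
  N = 2 %[mod 3] -> bbar r s k N = 0 %[mod 3].
Proof.
move=> Hr Hs HN; set P := prodE N (factor N); set Q := prodO N (factor N).
apply: (@bbar_cube _ _ _ _ (P ^+ u.+1 * Q ^+ v.+1) (theta 'X^1 N)).
  rewrite gpoly_split Hr Hs -/P -/Q.
  have -> : (P ^+ u.+1 * Q ^+ v.+1) ^+ 3 * theta 'X^1 N =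
      P ^+ (3 * u + 2) * Q ^+ (3 * v + 2) * (P * Q * theta 'X^1 N).
    rewrite exprMn -!exprM [(u.+1 * _)%N]mulnC [(v.+1 * _)%N]mulnC !mulnS.
    by rewrite ![(3 + _)%N]addnC !exprD; ring.
  by apply/eqm_sym/eqmM1; exact: theta_prodEO.
move=> m; rewrite HN => Hm; apply: coef_theta => j; apply/eqP => mE; move: Hm.
rewrite mE -modnMmr -modnXm; have := ltn_pmod j (isT : 0 < 3)%N.
by case: (j %% 3)%N => [|[|[|]]].
Qed.

Lemma bbar_mul3 r s k N :
  ~~ (3 %| N)%N -> bbar (3 * r) (3 * s) k N = 0 %[mod 3].
Proof.
move=> HN; apply: (@bbar_cube _ _ _ _ (gpoly r s k N) 1) => [|j Hj].
  rewrite mulr1 !gpoly_split exprMn -!exprM ![(_ * _ * 3)%N]mulnC !mulnA.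
  exact: eqm_refl.
by rewrite coef1; case: eqP => // j0; move: HN; rewrite /dvdn -Hj j0.
Qed.

End Congruences.

Theorem theorem1p11 (n r s k : nat) :
  [/\ bbar (3 * r) (3 * s) k (3 * n + 1) = 0 %[mod 3]
    & bbar (3 * r) (3 * s) k (3 * n + 2) = 0 %[mod 3]] /\
  [/\ bbar (3 * r + 1) (3 * s) (3 * k + 2) (3 * n + 1) = 0 %[mod 3]
    & bbar (3 * r + 2) (3 * s) (3 * k + 1) (3 * n + 1) = 0 %[mod 3]] /\
  [/\ bbar (3 * r + 1) (3 * s + 1) (3 * k + 2) (3 * n + 2) = 0 %[mod 3]
    & bbar (3 * r + 2) (3 * s + 2) (3 * k + 1) (3 * n + 2) = 0 %[mod 3]].
Proof.
have n1 : 3 * n + 1 = 1 %[mod 3] by rewrite mulnC modnMDl.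
have n2 : 3 * n + 2 = 2 %[mod 3] by rewrite mulnC modnMDl.
(* Residues 1 and 2 multiply to 2 modulo 3; the quotients serve as [u] and [v]. *)
have E12 a b : (3 * a + 1) * (3 * b + 2) = 3 * (3 * a * b + 2 * a + b) + 2.
  by ring.
have E21 a b : (3 * a + 2) * (3 * b + 1) = 3 * (3 * a * b + a + 2 * b) + 2.
  by ring.
split; first by split; apply: bbar_mul3; rewrite /dvdn ?n1 ?n2.
split; split.
- exact: bbar_phi_even (E12 r k) (esym (mulnA _ _ _)) n1.
- exact: bbar_phi_even (E21 r k) (esym (mulnA _ _ _)) n1.
- exact: bbar_phi (E12 r k) (E12 s k) n2.
- exact: bbar_phi (E21 r k) (E21 s k) n2.
Qed.
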